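(* For any positive rational number $\lambda<1$, there exist an integer $m\ge 1$, complex polynomials $P_0,\dots,P_m$ with $P_m\not\equiv 0$, and an entire function $f$ of order $\rho(f)=\lambda$ such that $f$ is a solution of the linear difference equation $$P_m(z)\Delta^m f(z)+\cdots+P_1(z)\Delta f(z)+P_0(z)f(z)=0.$$
   Context: $\Delta f(z)=f(z+1)-f(z)$, $\Delta^n f=\Delta(\Delta^{n-1}f)$ for $n\ge 1$, $\Delta^0 f=f$. For an entire function $f$, the order is $\rho(f)=\limsup_{r\to\infty}\frac{\log\log M(r,f)}{\log r}$ with $M(r,f)=\max_{|z|=r}|f(z)|$. *)

(* Defs.v *)
From HB Require Import structures.
From mathcomp Require Import all_boot all_order all_algebra.
From mathcomp Require Import complex.
From mathcomp Require Import all_classical all_reals all_analysis.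

Set Implicit Arguments.
Unset Strict Implicit.
Unset Printing Implicit Defensive.

Import Order.TTheory GRing.Theory Num.Theory.
Import numFieldNormedType.Exports.

Local Open Scope classical_set_scope.
Local Open Scope ring_scope.
Local Open Scope complex_scope.

Definition fdiff (R : realType) (f : R[i] -> R[i]) : R[i] -> R[i] :=
  fun z => f (z + 1) - f z.

(* The scalar field of R[i]^o is R[i], so the increment in this directional
   derivative ranges over complex numbers: this is complex differentiability. *)
Definition entire (R : realType) (f : R[i] -> R[i]) : Prop :=
  forall z : R[i], derivable (f : R[i]^o -> R[i]^o) z 1.

(* For continuous f and r >= 0 this supremum is attained; normc is the modulus
   with values in R, whereas the norm `|z| of R[i] has values in R[i]. *)
Definition max_modulus (R : realType) (f : R[i] -> R[i]) (r : R) : R :=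
  sup [set ComplexField.Normc.normc (f z) |
        z in [set z : R[i] | ComplexField.Normc.normc z = r]].

(* The convention ln x = 0 for x <= 0 only matters where max_modulus f r <= 1,
   hence, for entire f, at arbitrarily large r only when f is constant; every
   constant (including 0) gets order 0. *)
Definition growth_order (R : realType) (f : R[i] -> R[i]) : \bar R :=
  limf_esup (fun r : R => (ln (ln (max_modulus f r)) / ln r)%:E)
    (+oo%R : set_system R).

(* Main.v *)
(* Write lambda = p/q and x^(n) = x (x+1) ... (x+n-1).  The operator
   theta f (z) = z (f(z+1) - f(z)) multiplies z^(n) by n, and
   f(z) |-> z^(p) f(z+p) sends z^(n) to z^(n+p).  Hence
   f(z) = sum_k z^(pk) / (k!)^q, the image under x^n |-> z^(n) of a
   hypergeometric series, satisfies theta^q f (z) = p^q z^(p) f(z+p); since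
   p < q, the coefficient of Delta^q f in this equation is the leading
   coefficient of theta^q.
   All coefficients of the polynomials z^(pk) are nonnegative, so that
   M(r, f) = f(r).  For r = s^q, the bound r^(n) <= n^n s^((q-p)n) exp(s^p)
   gives f(r) <= exp(K s^p), and the single term k ~ s^p / 2 gives
   f(r) >= exp(c s^p); here s^p = r^lambda. *)
Require Import Defs.
From mathcomp Require Import all_boot all_order all_algebra.
From mathcomp Require Import complex.
From mathcomp Require Import all_classical all_reals all_analysis.
From mathcomp Require Import ring lra.

Set Implicit Arguments.
Unset Strict Implicit.
Unset Printing Implicit Defensive.

Import Order.TTheory GRing.Theory Num.Theory.
Import numFieldNormedType.Exports.

Local Open Scope ring_scope.
Local Open Scope complex_scope.

(** * Rising factorials *)

Definition rising {A : comNzRingType} (x : A) (n : nat) : A :=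
  \prod_(i < n) (x + i%:R).

Lemma rising0 {A : comNzRingType} (x : A) : rising x 0 = 1.
Proof. by rewrite /rising big_ord0. Qed.

Lemma risingS {A : comNzRingType} (x : A) n :
  rising x n.+1 = rising x n * (x + n%:R).
Proof. by rewrite /rising big_ord_recr. Qed.

Lemma risingD {A : comNzRingType} (x : A) m n :
  rising x (m + n) = rising x m * rising (x + m%:R) n.
Proof.
elim: n => [|n IHn]; first by rewrite addn0 rising0 mulr1.
by rewrite addnS !risingS IHn natrD !mulrA !addrA.
Qed.

(** Both sides are [rising x n.+1]. Subtracting [x * rising x n] gives the eigenvalue [n] of [theta]
    on [rising x n]. *)
Lemma rising_shift {A : comNzRingType} (x : A) n :
  x * rising (x + 1) n = rising x n * (x + n%:R).
Proof.
by rewrite -risingS -add1n risingD risingS rising0 mul1r addr0.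
Qed.

Lemma horner_risingX {A : comNzRingType} (x : A) n :
  (rising 'X n).[x] = rising x n.
Proof.
elim: n => [|n IHn]; first by rewrite !rising0 hornerE.
by rewrite !risingS hornerM IHn hornerD hornerX -polyC_natr hornerC.
Qed.

(** * The operator [theta] and shifts in terms of powers of the difference operator *)

Section Operators.
Context {R : realType}.
Implicit Types (f : R[i] -> R[i]) (z : R[i]).

Definition theta f z := z * fdiff f z.

(** Induction with the product rule D(Q g)(z) = Q(z+1) Dg(z) + (Q(z+1) - Q(z)) g(z), D being
    [fdiff]. The vanishing of [P k] beyond [n] lets the two resulting sums share one index range. *)
Lemma theta_repr n : exists P : nat -> {poly R[i]},
  [/\ P n != 0, forall k, (n < k)%N -> P k = 0 &
      forall f z, iter n theta f z
        = \sum_(k < n.+1) (P k).[z] * iter k (@fdiff R) f z].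
Proof.
elim: n => [|n [P [Pn0 Pgt Peq]]].
  exists (fun k => (k == 0%N)%:R); split => [|[|k]|f z] //=.
    by rewrite oner_eq0.
  by rewrite big_ord1 /= hornerE mul1r.
pose S (Q : {poly R[i]}) := Q \Po ('X + 1).
pose prev k := if k is j.+1 then S (P j) else 0.
exists (fun k => 'X * (prev k + (S (P k) - P k))).
split=> [|[|k] //|f z].
- rewrite /prev (Pgt n.+1) // /S comp_poly0 subr0 addr0 mulf_neq0 ?polyX_eq0 //.
  (* The new leading coefficient is ['X * S (P n)], and substituting the degree-one polynomial
     ['X + 1] keeps [P n] nonzero. *)
  have := comp_poly2_eq0 (P n) (q := 'X + 1).
  by rewrite -[1]/(1%:P) size_XaddC => -> //.
- rewrite ltnS /= => nk; rewrite !Pgt // ?(leq_trans nk) //.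
  by rewrite /S !comp_poly0 subr0 addr0 mulr0.
- rewrite iterS /theta /fdiff.
  have hS Q x : (S Q).[x] = Q.[x + 1] by rewrite /S horner_comp !hornerE.
  transitivity (z * (\sum_(k < n.+2) (prev k).[z] * iter k (@fdiff R) f z +
      \sum_(k < n.+2) ((S (P k)).[z] - (P k).[z]) * iter k (@fdiff R) f z));
    last first.
    rewrite -big_split /= big_distrr /=; apply: eq_bigr => k _.
    by rewrite hornerM hornerX hornerD hornerD hornerN; ring.
  congr (_ * _); rewrite -/(theta) !Peq.
  rewrite [X in _ = X + _]big_ord_recl /= horner0 mul0r add0r.
  rewrite [X in _ = _ + X]big_ord_recr /=.
  rewrite (Pgt n.+1) // /S comp_poly0 !horner0 subrr mul0r addr0.
  rewrite -big_split -sumrB /=; apply: eq_bigr => k _.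
  rewrite hS /bump /= /fdiff !add0n; ring.
Qed.

(** Binomial expansion of (1 + D)^n, D being [fdiff]. The free bound [N] pads the sum with zero
    binomials, to match the range of [theta_repr]. *)
Lemma shift_repr N n f z : (n < N)%N ->
  f (z + n%:R) = \sum_(k < N) 'C(n, k)%:R * iter k (@fdiff R) f z.
Proof.
elim: n z => [|n IHn] z.
  case: N => // N _; rewrite big_ord_recl /= bin0 mul1r big1 ?addr0 // => i _.
  by rewrite bin0n mul0r.
case: N IHn => // N IHn nN.
rewrite mulrS addrA IHn ?(ltnW nN) //.
transitivity (\sum_(k < N.+1) 'C(n, k)%:R * iter k (@fdiff R) f z
   + \sum_(k < N.+1) 'C(n, k)%:R * iter k.+1 (@fdiff R) f z).
  by rewrite -big_split /=; apply: eq_bigr => k _; rewrite /fdiff; ring.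
rewrite [X in _ + X]big_ord_recr /= bin_small // mul0r addr0.
rewrite big_ord_recl [RHS]big_ord_recl /= !bin0 -addrA -big_split /=; congr (_ + _).
by apply: eq_bigr => k _; rewrite /bump /= add1n binS natrD mulrDl.
Qed.

End Operators.

(** * Taylor estimates for polynomials with nonnegative coefficients *)

Section NonnegCoefficients.
Context {K : numFieldType}.
Implicit Types (p : {poly K}) (z h : K).

Lemma norm_horner_le p z : (forall i, 0 <= p`_i) -> `|p.[z]| <= p.[`|z|].
Proof.
move=> p0; rewrite !horner_coef; apply: le_trans (ler_norm_sum _ _ _) _.
by apply: ler_sum => i _; rewrite normrM normrX (ger0_norm (p0 _)).
Qed.

Lemma nderivn_coef_ge0 p n : (forall i, 0 <= p`_i) ->
  forall i, 0 <= p^`N(n)`_i.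
Proof. by move=> p0 i; rewrite coef_nderivn mulrn_wge0. Qed.

Lemma horner_norm_ge0 p z : (forall i, 0 <= p`_i) -> 0 <= p.[`|z|].
Proof. by move=> p0; exact: le_trans (normr_ge0 _) (norm_horner_le z p0). Qed.

Lemma taylor_split p z h : p.[z + h] = p.[z] + h * p^`().[z] +
  \sum_(i < size p) p^`N(i.+2).[z] * h ^+ i.+2.
Proof.
rewrite (@nderiv_taylor_wide _ (size p).+2 p z h (mulrC _ _)) ?leqW //.
by rewrite !big_ord_recl /= nderivn0 mulr1 nderivn1 expr1 [h * _]mulrC addrA.
Qed.

(** p'(|z|) is one of the nonnegative terms in the Taylor expansion of p(|z| + 1) at |z|. Hence the
    differentiated series has the same kind of majorant as the series itself. *)
Lemma norm_deriv_le p z : (forall i, 0 <= p`_i) ->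
  `|p^`().[z]| <= p.[`|z| + 1].
Proof.
move=> p0; have d0 n := nderivn_coef_ge0 n p0.
apply: le_trans (norm_horner_le _ _) _; first by rewrite -nderivn1; exact: d0.
rewrite taylor_split mul1r addrAC lerDr addr_ge0 ?horner_norm_ge0 //.
by apply: sumr_ge0 => i _; rewrite expr1n mulr1 horner_norm_ge0.
Qed.

(* The terms of order at least 2 in the Taylor expansion at |z| are nonnegative,
   and |h|^i <= |h|^2 for i >= 2; summing this bound over a series of such
   polynomials shows that the sum is complex differentiable. *)
Lemma norm_taylor_remainder_le p z h : (forall i, 0 <= p`_i) -> `|h| <= 1 ->
  `|p.[z + h] - p.[z] - h * p^`().[z]| <= `|h| ^+ 2 * p.[`|z| + 1].
Proof.
move=> p0 h1; have d0 n := nderivn_coef_ge0 n p0.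
rewrite taylor_split -addrA -opprD [_ + _ - _]addrC addKr.
rewrite taylor_split mulrDr; apply: ler_wpDl.
  rewrite mulr_ge0 ?exprn_ge0 // mul1r addr_ge0 ?horner_norm_ge0 //.
  by rewrite -nderivn1; exact: d0.
apply: le_trans (ler_norm_sum _ _ _) _; rewrite mulr_sumr.
apply: ler_sum => i _; rewrite normrM normrX expr1n mulr1 mulrC -addn2 addnC exprD.
rewrite -mulrA ler_wpM2l ?exprn_ge0 // -[leRHS]mul1r.
by rewrite ler_pM ?exprn_ge0 ?norm_horner_le ?exprn_ile1.
Qed.

Lemma rising_coef_ge0 n i : 0 <= (rising 'X n : {poly K})`_i.
Proof.
elim: n i => [|n IHn] i; first by rewrite rising0 coef1 ler0n.
rewrite risingS mulrDr coefD coefMX -polyC_natr mulrC coefCM.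
by case: i => [|i] /=; rewrite ?add0r ?addr_ge0 ?mulr_ge0.
Qed.

End NonnegCoefficients.

(** * Limits of complex sequences *)

Section ComplexSequences.
Context {R : realType}.
Import ComplexField.Normc.
Implicit Types (s t u : nat -> R[i]) (l m : R[i]).

Local Open Scope classical_set_scope.

(** Convergence is taken componentwise, so that limits reduce to the real theory. *)
Definition ccvg s l :=
  (fun n => complex.Re (s n)) @ \oo --> complex.Re l /\
  (fun n => complex.Im (s n)) @ \oo --> complex.Im l.

Lemma ccvg_unique s l m : ccvg s l -> ccvg s m -> l = m.
Proof.
case=> sl sl' [sm sm']; apply/eqP; rewrite eq_complex.
by rewrite (cvg_unique _ sl sm) ?(cvg_unique _ sl' sm') ?eqxx //; exact: Rhausdorff.
Qed.

Lemma ReB l m : complex.Re (l - m) = complex.Re l - complex.Re m.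
Proof. by case: l m => ? ? []. Qed.

Lemma ImB l m : complex.Im (l - m) = complex.Im l - complex.Im m.
Proof. by case: l m => ? ? []. Qed.

Lemma ccvgB s t l m : ccvg s l -> ccvg t m -> ccvg (fun n => s n - t n) (l - m).
Proof.
case=> sl sl' [tm tm']; split.
  by rewrite ReB; under eq_fun do rewrite ReB; exact: cvgB.
by rewrite ImB; under eq_fun do rewrite ImB; exact: cvgB.
Qed.

Lemma ccvgZ a s l : ccvg s l -> ccvg (fun n => a * s n) (a * l).
Proof.
case: a => a b [sl sl']; split.
  rewrite [X in _ --> X](_ : _ = a * complex.Re l - b * complex.Im l);
    last by case: l {sl sl'}.
  rewrite [X in X @ _]
    (_ : _ = fun n => a * complex.Re (s n) - b * complex.Im (s n)); last first.
    by apply/funext => n; case: (s n).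
  by apply: cvgB; apply: cvgMr.
rewrite [X in _ --> X](_ : _ = a * complex.Im l + b * complex.Re l);
    last by case: l {sl sl'}.
rewrite [X in X @ _]
  (_ : _ = fun n => a * complex.Im (s n) + b * complex.Re (s n)); last first.
  by apply/funext => n; case: (s n).
by apply: cvgD; apply: cvgMr.
Qed.

Lemma ccvg_shiftS s l : ccvg s l -> ccvg (fun n => s n.+1) l.
Proof.
case=> sl sl'; split.
  by have := cvg_shiftS (fun n => complex.Re (s n)) (nbhs (complex.Re l)) => /= ->.
by have := cvg_shiftS (fun n => complex.Im (s n)) (nbhs (complex.Im l)) => /= ->.
Qed.

Lemma normc_sqr l : normc l ^+ 2 = complex.Re l ^+ 2 + complex.Im l ^+ 2.
Proof. by case: l => a b; rewrite /normc sqr_sqrtr ?addr_ge0 ?sqr_ge0. Qed.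

Lemma normc_ge0 l : 0 <= normc l.
Proof. by case: l => a b; rewrite /normc sqrtr_ge0. Qed.

Lemma normr_complexE l : `|l| = (normc l)%:C. Proof. by case: l. Qed.

Lemma norm_Re_le l : `|complex.Re l| <= normc l.
Proof.
rewrite -(@ler_pXn2r _ 2) ?nnegrE ?normc_ge0 // real_normK ?num_real //.
by rewrite normc_sqr lerDl sqr_ge0.
Qed.

Lemma norm_Im_le l : `|complex.Im l| <= normc l.
Proof.
rewrite -(@ler_pXn2r _ 2) ?nnegrE ?normc_ge0 // real_normK ?num_real //.
by rewrite normc_sqr lerDr sqr_ge0.
Qed.

Lemma ccvg_norm_le s l B : ccvg s l -> (forall n, normc (s n) <= B) ->
  normc l <= B.
Proof.
case=> sl sl' sB; have B0 : 0 <= B := le_trans (normc_ge0 _) (sB 0%N).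
rewrite -(@ler_pXn2r _ 2) ?nnegrE ?normc_ge0 // normc_sqr.
(* Squaring removes the root in [normc] and leaves a polynomial in the two components. *)
have sq : (fun n => normc (s n) ^+ 2) @ \oo -->
    complex.Re l ^+ 2 + complex.Im l ^+ 2.
  by under eq_fun do rewrite normc_sqr !expr2; rewrite !expr2;
     apply: cvgD; apply: cvgM.
rewrite -(cvg_lim _ sq) //; apply: limr_le.
  by apply/cvg_ex; eexists; exact: sq.
by apply: nearW => n; rewrite ler_pXn2r ?nnegrE ?normc_ge0.
Qed.

(** Real and imaginary parts converge absolutely by comparison with [a]; [key] treats both as
    additive maps bounded by the modulus. *)
Lemma ccvg_dominated u (a : nat -> R) : (forall k, normc (u k) <= a k) ->
  cvgn (series a) -> exists l, ccvg (fun n => \sum_(k < n) u k) l.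
Proof.
move=> ua cva.
have key (g : R[i] -> R) : g 0 = 0 -> {morph g : x y / x + y} ->
    (forall l, `|g l| <= normc l) ->
    exists x : R, (fun n => g (\sum_(k < n) u k)) @ \oo --> x.
  move=> g0 gD gle.
  have /normed_cvg/cvg_ex[x xP] : cvgn (series (fun k => `|g (u k)|)).
    apply: series_le_cvg cva => k //=; last exact: le_trans (gle _) (ua k).
    exact: le_trans (normc_ge0 _) (ua k).
  exists x.
  under eq_fun do
    rewrite (big_morph g gD g0) -(big_mkord xpredT (fun k => g (u k))).
  exact: xP.
have [x xP] := key (@complex.Re R) erefl ltac:(by case=> ? ? []) norm_Re_le.
have [y yP] := key (@complex.Im R) erefl ltac:(by case=> ? ? []) norm_Im_le.
by exists (x +i* y).
Qed.

End ComplexSequences.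

(** * Real bounds for the terms of the series, and limits superior *)

Section Growth.
Context {R : realType}.
Implicit Types (x y s r : R).

Local Open Scope classical_set_scope.

Lemma rising_ge0 x n : 0 <= x -> 0 <= rising x n.
Proof. by move=> x0; apply: prodr_ge0 => i _; rewrite addr_ge0. Qed.

Lemma ler_rising x y n : 0 <= x -> x <= y -> rising x n <= rising y n.
Proof.
by move=> x0 xy; apply: ler_prod => i _; rewrite addr_ge0 ?ler0n ?lerD2r ?xy.
Qed.

Lemma rising_ge x n : 0 <= x -> x ^+ n <= rising x n.
Proof.
move=> x0; have -> : x ^+ n = \prod_(i < n) x by rewrite prodr_const card_ord.
by apply: ler_prod => i _; rewrite x0 lerDl ler0n.
Qed.

Lemma rising_le x n : 0 <= x -> rising x n <= (x + n%:R) ^+ n.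
Proof.
move=> x0; have -> : (x + n%:R) ^+ n = \prod_(i < n) (x + n%:R).
  by rewrite prodr_const card_ord.
by apply: ler_prod => i _; rewrite addr_ge0 //= lerD2l ler_nat ltnW.
Qed.

(** For n > 0 and s >= 1, s^(p+d) + n <= n s^d (1 + s^p/n) <= n s^d exp(s^p/n); then take n-th
    powers. *)
Lemma rising_le_expR s p d n : 1 <= s ->
  rising (s ^+ (p + d)) n <= n%:R ^+ n * s ^+ (d * n) * expR (s ^+ p).
Proof.
move=> s1; have s0 : 0 <= s by apply: le_trans s1.
apply: le_trans (rising_le _ (exprn_ge0 _ s0)) _.
case: n => [|n]; first by rewrite muln0 !expr0 !mul1r -[1]expR0 ler_expR exprn_ge0.
set N : R := n.+1%:R; have N0 : 0 < N by rewrite ltr0n.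
have -> : expR (s ^+ p) = expR (s ^+ p / N) ^+ n.+1.
  by rewrite -expRM_natl mulrC divfK // gt_eqF.
rewrite exprM -!exprMn ler_pXn2r ?nnegrE //; last 2 first.
- by rewrite addr_ge0 ?exprn_ge0 // ltW.
- by rewrite !mulr_ge0 ?exprn_ge0 ?expR_ge0 // ltW.
apply: (@le_trans _ _ (N * s ^+ d * (1 + s ^+ p / N))).
  have -> : N * s ^+ d * (1 + s ^+ p / N) = s ^+ (p + d) + N * s ^+ d.
    by rewrite exprD; field; rewrite gt_eqF.
  by rewrite lerD2l ler_peMr ?exprn_ege1 // ltW.
by rewrite ler_wpM2l ?expR_ge1Dx // mulr_ge0 ?exprn_ge0 // ltW.
Qed.

Lemma sum_exp_coeff_le y n : 0 <= y -> \sum_(k < n) y ^+ k / k`!%:R <= expR y.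
Proof.
move=> y0; rewrite -(big_mkord xpredT (fun k => y ^+ k / k`!%:R)).
apply: (nondecreasing_cvgn_le _ (is_cvg_series_exp_coeff y)).
apply: nondecreasing_series => k _ _; exact: exp_coeff_ge0.
Qed.

Lemma exp_coeff_le y n : 0 <= y -> y ^+ n / n`!%:R <= expR y.
Proof.
move=> y0; apply: le_trans (sum_exp_coeff_le n.+1 y0).
rewrite big_ord_recr /= lerDr sumr_ge0 // => k _.
by rewrite mulr_ge0 ?exprn_ge0 ?invr_ge0.
Qed.

(** The constant (p e)^p satisfies (pk)^(pk) <= ((p e)^p)^k (k!)^p, because k^k <= e^k k!. *)
Definition growth_base p : R := (p%:R * expR 1) ^+ p.

Lemma growth_base_ge1 p : 1 <= growth_base p.
Proof.
case: p => [|p]; first by rewrite /growth_base expr0.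
rewrite exprn_ege1 // -[X in X <= _]mulr1 ler_pM // ?ler1n //.
by rewrite -[X in X <= _]expR0 ler_expR.
Qed.

(** In [rising_le_expR] with n = pk, p of the p+d factors 1/k! absorb (pk)^(pk); the other d turn
    s^(dpk) into the d-th power of an exponential coefficient. *)
Lemma term_le s p d k : (0 < d)%N -> 1 <= s ->
  k`!%:R^-1 ^+ (p + d) * rising (s ^+ (p + d)) (p * k)
  <= expR (s ^+ p) * ((growth_base p * s ^+ p) ^+ k / k`!%:R) ^+ d.
Proof.
move=> d0 s1; have s0 : 0 <= s by apply: le_trans s1.
have f0 : 0 < k`!%:R :> R by rewrite ltr0n fact_gt0.
have [C CE] : exists C, C = growth_base p by exists (growth_base p).
rewrite -CE; have C1 : 1 <= C by rewrite CE growth_base_ge1.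
have -> : expR (s ^+ p) * ((C * s ^+ p) ^+ k / k`!%:R) ^+ d
  = k`!%:R^-1 ^+ (p + d) *
    ((C ^+ k) ^+ d * k`!%:R ^+ p * s ^+ (d * (p * k)) * expR (s ^+ p)).
  rewrite exprD !exprMn -!exprM [(d * _)%N]mulnC !mulnA.
  rewrite [X in _ = X](_ : _ = (k`!%:R^-1 ^+ p * k`!%:R ^+ p) *
    (expR (s ^+ p) * (C ^+ (k * d) * s ^+ (p * k * d) * k`!%:R^-1 ^+ d)));
    last by ring.
  by rewrite -exprMn mulVf ?gt_eqF // expr1n mul1r.
rewrite ler_wpM2l ?exprn_ge0 ?invr_ge0 //.
apply: le_trans (rising_le_expR _ _ _ s1) _.
rewrite ler_wpM2r ?expR_ge0 // ler_wpM2r ?exprn_ge0 //.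
(* As C >= 1 and d > 0, C^k is at most (C^k)^d. *)
apply: (@le_trans _ _ (C ^+ k * k`!%:R ^+ p)); last first.
  by rewrite ler_wpM2r ?exprn_ge0 // ler_eXnr // exprn_ege1.
rewrite CE /growth_base -exprM natrM exprMn exprMn -mulrA ler_wpM2l ?exprn_ge0 //.
rewrite mulnC !exprM -exprMn.
apply: lerXn2r; rewrite ?nnegrE ?mulr_ge0 ?exprn_ge0 ?expR_ge0 //.
(* This is k^k / k! <= exp(k), a single term of the exponential series at k. *)
by rewrite -expRM_natl mulr1 -ler_pdivrMr // exp_coeff_le.
Qed.

(** With y = [growth_base p * s ^+ p], bound d-1 of the d factors y^k/k! by exp(y) and sum the last
    one, again to at most exp(y). *)
Lemma sum_term_le s p d n : (0 < d)%N -> 1 <= s ->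
  \sum_(k < n) k`!%:R^-1 ^+ (p + d) * rising (s ^+ (p + d)) (p * k)
  <= expR ((1 + d%:R * growth_base p) * s ^+ p).
Proof.
move=> d0 s1; have s0 : 0 <= s by apply: le_trans s1.
apply: (@le_trans _ _ (\sum_(k < n)
    expR (s ^+ p) * ((growth_base p * s ^+ p) ^+ k / k`!%:R) ^+ d)).
  by apply: ler_sum => k _; exact: term_le.
rewrite -mulr_sumr mulrDl mul1r expRD ler_wpM2l ?expR_ge0 // -mulrA expRM_natl.
set y := growth_base p * s ^+ p.
have y0 : 0 <= y.
  by rewrite mulr_ge0 ?exprn_ge0 //; apply: le_trans (growth_base_ge1 p).
case: d d0 => // d _; rewrite exprSr.
apply: le_trans (ler_wpM2l (exprn_ge0 _ (expR_ge0 _)) (sum_exp_coeff_le n y0)).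
rewrite mulr_sumr; apply: ler_sum => k _; rewrite exprSr.
have t0 : 0 <= y ^+ k / k`!%:R by rewrite mulr_ge0 ?exprn_ge0 ?invr_ge0.
by rewrite ler_wpM2r // lerXn2r ?nnegrE ?expR_ge0 // exp_coeff_le.
Qed.

Lemma pow2_fact_le x k : (k.*2)%:R <= x -> 2 ^+ k * k`!%:R <= x ^+ k.
Proof.
move=> kx; have x0 : 0 <= x by apply: le_trans kx.
(* Keeping [k] fixed bounds every factor: 2j <= 2k <= x. *)
suff H j : (j <= k)%N -> 2 ^+ j * j`!%:R <= x ^+ j by exact: H.
elim: j => [_|j IHj jk]; first by rewrite !expr0 mul1r.
rewrite exprS factS natrM exprS mulrACA.
rewrite ler_pM ?mulr_ge0 ?exprn_ge0 ?IHj ?(ltnW jk) //.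
by apply: le_trans kx; rewrite -natrM ler_nat mul2n leq_double.
Qed.

(** With x = s^p, the term is at least (x^k/k!)^q, and x^k/k! >= 2^k as soon as 2k <= x. *)
Lemma term_ge s p q k : 1 <= s -> (0 < q)%N -> (k.*2)%:R <= s ^+ p ->
  2 ^+ k <= k`!%:R^-1 ^+ q * rising (s ^+ q) (p * k).
Proof.
move=> s1 q0 ks; have s0 : 0 <= s by apply: le_trans s1.
apply: (@le_trans _ _ ((2 ^+ k) ^+ q)).
  by rewrite ler_eXnr // exprn_ege1 // ler1n.
apply: (@le_trans _ _ (k`!%:R^-1 ^+ q * (s ^+ q) ^+ (p * k))); last first.
  by rewrite ler_wpM2l ?exprn_ge0 ?invr_ge0 // rising_ge ?exprn_ge0.
rewrite [(s ^+ q) ^+ _]exprAC -exprMn.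
rewrite ler_pXn2r ?nnegrE ?mulr_ge0 ?exprn_ge0 ?invr_ge0 //.
by rewrite mulrC ler_pdivlMr ?ltr0n ?fact_gt0 // exprM pow2_fact_le.
Qed.

(** One set of the filter gives the upper bound l + e; for the lower bound, each set of the proper
    filter [F] meets the set where g >= l - e. *)
Lemma limf_esup_fin (F : set_system R) (g : R -> R) (l : R) :
  ProperFilter F -> g @ F --> l -> limf_esup (fun r => (g r)%:E) F = l%:E.
Proof.
move=> PF gl; rewrite limf_esupE.
apply/eqP; rewrite eq_le; apply/andP; split.
  apply/lee_addgt0Pr => e e0.
  have Fe : F [set r | g r <= l + e].
    by apply: (cvgr_le _ gl); rewrite ltrDl.
  apply: (@le_trans _ _ (ereal_sup ((fun r => (g r)%:E) @` [set r | g r <= l + e]))).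
    by apply: ereal_inf_lbound; eexists; first exact: Fe.
  by apply: ge_ereal_sup => _ [r rle <-]; rewrite -EFinD lee_fin.
apply: le_ereal_inf_tmp => _ [V FV <-]; apply/lee_subgt0Pr => e e0.
have Fe : F [set r | l - e <= g r].
  by apply: (cvgr_ge _ gl); rewrite gtrDl oppr_lt0.
have [r [Vr rle]] := filter_ex (filterI FV Fe).
apply: (@le_trans _ _ (g r)%:E); first by rewrite -EFinB lee_fin.
by apply: ereal_sup_ubound; exists r.
Qed.

End Growth.

(** * The series for [f] and its real majorant *)

Section Solution.
Context {R : realType} (p d : nat) (p_gt0 : (0 < p)%N) (d_gt0 : (0 < d)%N).
Import ComplexField.Normc.
Implicit Types (r s : R) (z h : R[i]).

Local Open Scope classical_set_scope.

Local Notation q := (p + d)%N.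

(** Generic in the field, since the real series at |z| majorizes the complex series at z. *)
Definition term {A : fieldType} (x : A) (k : nat) : A :=
  k`!%:R^-1 ^+ q * rising x (p * k).

Lemma term_real r k : term r%:C k = (term r k)%:C.
Proof.
rewrite /term rmorphM rmorphXn fmorphV rmorph_nat; congr (_ * _).
rewrite /rising rmorph_prod; apply: eq_bigr => i _.
by rewrite rmorphD rmorph_nat.
Qed.

Lemma term_ge0 r k : 0 <= r -> 0 <= term r k.
Proof. by move=> r0; rewrite mulr_ge0 ?exprn_ge0 ?invr_ge0 ?rising_ge0. Qed.

Lemma normc_term_le z k : normc (term z k) <= term (normc z) k.
Proof.
rewrite -lecR -normr_complexE -term_real /term normrM normrX normfV normr_nat.
rewrite ler_wpM2l ?exprn_ge0 ?invr_ge0 // normr_prod -normr_complexE.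
apply: ler_prod => i _; rewrite normr_ge0 /=.
by apply: le_trans (ler_normD _ _) _; rewrite normr_nat.
Qed.

Lemma nondecreasing_series_term r : 0 <= r ->
  nondecreasing_seq (series (term r)).
Proof. by move=> r0; apply: nondecreasing_series => k _ _; exact: term_ge0. Qed.

Lemma is_cvg_series_term r : 0 <= r -> cvgn (series (term r)).
Proof.
move=> r0; apply: nondecreasing_is_cvgn; first exact: nondecreasing_series_term.
(* [sum_term_le] applies at q-th powers of numbers at least 1, so r is compared with (1 + r)^q. *)
have s1 : 1 <= 1 + r by rewrite lerDl.
eexists => _ [n _ <-]; rewrite /series /= big_mkord.
apply: le_trans (sum_term_le p n d_gt0 s1); apply: ler_sum => k _.
rewrite ler_wpM2l ?exprn_ge0 ?invr_ge0 // ler_rising //.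
apply: le_trans (_ : r <= 1 + r) _; first by rewrite lerDr.
by rewrite ler_eXnr // addn_gt0 p_gt0.
Qed.

Definition growth r : R := limn (series (term r)).

Lemma sum_term_growth r n : 0 <= r -> \sum_(k < n) term r k <= growth r.
Proof.
move=> r0; rewrite -(big_mkord xpredT (term r)).
exact: nondecreasing_cvgn_le (nondecreasing_series_term r0)
  (is_cvg_series_term r0) n.
Qed.

Lemma growth_ge0 r : 0 <= r -> 0 <= growth r.
Proof. by move=> /(sum_term_growth 0); rewrite big_ord0. Qed.

Lemma growth_le s : 1 <= s ->
  growth (s ^+ q) <= expR ((1 + d%:R * growth_base p) * s ^+ p).
Proof.
move=> s1; have s0 : 0 <= s by apply: le_trans s1.
apply: limr_le; first by apply: is_cvg_series_term; rewrite exprn_ge0.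
by apply: nearW => n; rewrite /series /= big_mkord; exact: sum_term_le.
Qed.

Lemma growth_ge s : 1 <= s -> 4 <= s ^+ p ->
  expR (ln 2 / 4 * s ^+ p) <= growth (s ^+ q).
Proof.
move=> s1 x4; have s0 : 0 <= s by apply: le_trans s1.
set x := s ^+ p in x4 *; pose k := Num.truncn (x / 2).
have /andP[kx xk] : k%:R <= x / 2 < k.+1%:R by apply: truncn_itv; lra.
have tk : 2 ^+ k <= term (s ^+ q) k.
  apply: term_ge; rewrite ?addn_gt0 ?p_gt0 //.
  by rewrite -muln2 natrM -ler_pdivlMr.
have le_term : term (s ^+ q) k <= growth (s ^+ q).
  apply: le_trans (sum_term_growth k.+1 (exprn_ge0 _ s0)).
  rewrite big_ord_recr /= lerDr sumr_ge0 // => j _.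
  by rewrite term_ge0 ?exprn_ge0.
apply: le_trans (le_trans tk le_term).
have ln2 : 0 < ln 2 :> R by rewrite ln_gt0 // ltr1n.
rewrite -[X in X ^+ k]lnK ?posrE // -expRM_natl ler_expR.
(* The choice of [k] gives k > x/2 - 1, which is at least x/4 because x >= 4. *)
have kx4 : x / 4 <= k%:R by rewrite -[k.+1]addn1 natrD in xk; lra.
by rewrite mulrAC -mulrA mulrC ler_wpM2r // ltW.
Qed.

(** * The sum of the series: maximum modulus, differentiability, functional equation, order *)

Section Sum.
Context (f : R[i] -> R[i])
  (fP : forall z, ccvg (fun n => \sum_(k < n) term z k) (f z)).

Lemma normc_sum_le z : normc (f z) <= growth (normc z).
Proof.
apply: ccvg_norm_le (fP z) _ => n.
apply: le_trans (sum_term_growth n (normc_ge0 z)).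
rewrite -lecR -normr_complexE rmorph_sum /=.
apply: le_trans (ler_norm_sum _ _ _) _; apply: ler_sum => k _.
by rewrite normr_complexE lecR normc_term_le.
Qed.

Lemma sum_real r : 0 <= r -> f r%:C = (growth r)%:C.
Proof.
move=> r0; apply: ccvg_unique (fP _) _.
have eqS n : \sum_(k < n) term r%:C k = (series (term r) n)%:C.
  rewrite /series /= big_mkord rmorph_sum.
  by apply: eq_bigr => k _; rewrite term_real.
split; under eq_fun do rewrite eqS /=; last exact: cvg_cst.
exact: is_cvg_series_term.
Qed.

(** The majorant [growth r] is attained at the real point r of the circle. *)
Lemma max_modulus_sum r : 0 <= r -> max_modulus f r = growth r.
Proof.
move=> r0; rewrite /max_modulus; set E := [set _ | _ in _].
have normcR (x : R) : 0 <= x -> normc x%:C = x.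
  by move=> x0; rewrite /normc /= expr0n addr0 sqrtr_sqr ger0_norm.
have ubE : ubound E (growth r).
  by move=> _ [z <- <-]; exact: normc_sum_le.
have Er : E (growth r).
  exists r%:C; first exact: normcR.
  by rewrite sum_real // normcR // growth_ge0.
apply/eqP; rewrite eq_le ge_sup //=; last by exists (growth r).
by apply: ub_le_sup => //; exists (growth r).
Qed.

(** The derivative is the sum [g] of the termwise derivatives: the Taylor remainder bounds add up to
    |h|^2 [growth (normc z + 1)], which is o(|h|). *)
Lemma entire_sum : entire f.
Proof.
move=> z; pose P k : {poly R[i]} := rising 'X (p * k).
pose c k : R[i] := k`!%:R^-1 ^+ q.
have c0 k : 0 <= c k by rewrite exprn_ge0 ?invr_ge0.
have P0 k i : 0 <= (P k)`_i by exact: rising_coef_ge0.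
have cP (x : R[i]) k : c k * (P k).[x] = term x k by rewrite /P horner_risingX.
have Pz k : c k * (P k).[`|z| + 1] = (term (normc z + 1) k)%:C.
  by rewrite cP normr_complexE -term_real rmorphD.
have nz1 : 0 <= normc z + 1 by rewrite addr_ge0 ?normc_ge0.
have [g gP] : exists l, ccvg (fun n => \sum_(k < n) c k * (P k)^`().[z]) l.
  apply: (@ccvg_dominated _ (fun k => c k * (P k)^`().[z]) _ _
    (is_cvg_series_term nz1)) => k.
  rewrite -lecR -normr_complexE normrM (ger0_norm (c0 k)) -Pz.
  by rewrite ler_wpM2l // norm_deriv_le.
have rem h : `|h| <= 1 ->
    `|f (z + h) - f z - h * g| <= `|h| ^+ 2 * (growth (normc z + 1))%:C.
  move=> h1; have cvg := ccvgB (ccvgB (fP (z + h)) (fP z)) (ccvgZ h gP).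
  rewrite !normr_complexE -rmorphXn -rmorphM lecR; apply: ccvg_norm_le cvg _ => n.
  apply: le_trans (ler_wpM2l (exprn_ge0 _ (normc_ge0 h)) (sum_term_growth n nz1)).
  rewrite -lecR -normr_complexE mulr_sumr -!sumrB.
  have -> : (normc h ^+ 2 * \sum_(k < n) term (normc z + 1) k)%:C =
      \sum_(k < n) `|h| ^+ 2 * (term (normc z + 1) k)%:C.
    by rewrite -mulr_sumr normr_complexE rmorphM rmorphXn rmorph_sum.
  apply: le_trans (ler_norm_sum _ _ _) _; apply: ler_sum => k _.
  rewrite -!cP mulrCA -!mulrBr normrM (ger0_norm (c0 k)) -Pz mulrCA.
  by rewrite ler_wpM2l // norm_taylor_remainder_le.
set K := (growth (normc z + 1))%:C in rem.
have K0 : 0 <= K by rewrite (lecR 0) growth_ge0.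
(* Dividing by K + 1 avoids the possibility K = 0. *)
have K1 : 0 < K + 1 by rewrite ltr_wpDl.
apply/cvg_ex; exists (g : R[i]^o); apply/cvgrPdist_le => e e0; near=> h.
have h0 : h != 0 by near: h; exact: nbhs_dnbhs_neq.
have h1 : `|h| <= 1 by near: h; exact: dnbhs0_le.
have he : `|h| <= e / (K + 1) by near: h; apply: dnbhs0_le; rewrite divr_gt0.
have -> : g - h^-1 *: ((f \o shift z) (h *: 1) - f z)
    = - (h^-1 * (f (z + h) - f z - h * g)).
  rewrite /= /GRing.scale /= mulr1 [h + z]addrC; field; exact: h0.
rewrite normrN normrM normfV.
apply: (@le_trans _ _ (`|h|^-1 * (`|h| ^+ 2 * K))).
  by rewrite ler_wpM2l ?invr_ge0 // rem.
rewrite expr2 !mulrA mulVf ?normr_eq0 // mul1r.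
apply: (@le_trans _ _ (e / (K + 1) * (K + 1))); last by rewrite divfK // gt_eqF.
by rewrite ler_pM // lerDl.
Unshelve. all: by end_near.
Qed.

(** [theta] multiplies the k-th term by pk, and it passes to the limit because it involves only the
    values at z and z + 1. *)
Lemma iter_theta_cvg j z :
  ccvg (fun n => \sum_(k < n) (p * k)%:R ^+ j * term z k) (iter j theta f z).
Proof.
elim: j z => [|j IHj] z.
  by under eq_fun do under eq_bigr do rewrite expr0 mul1r; exact: fP.
have := ccvgZ z (ccvgB (IHj (z + 1)) (IHj z)).
congr ccvg; apply/funext => n; rewrite -sumrB mulr_sumr.
apply: eq_bigr => k _; rewrite /term exprSr.
transitivity ((p * k)%:R ^+ j * k`!%:R^-1 ^+ q *
   (z * rising (z + 1) (p * k) - z * rising z (p * k))); first by ring.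
by rewrite rising_shift; ring.
Qed.

(** The term k = 0 is killed since q > 0. After reindexing, (p(k+1))^q / ((k+1)!)^q = p^q / (k!)^q,
    and [risingD] splits off [rising z p]. *)
Lemma iter_theta_sum z :
  iter q theta f z = p%:R ^+ q * rising z p * f (z + p%:R).
Proof.
apply: ccvg_unique (ccvg_shiftS (iter_theta_cvg q z)) _.
have := ccvgZ (p%:R ^+ q * rising z p) (fP (z + p%:R)).
congr ccvg; apply/funext => n; rewrite big_ord_recl muln0 expr0n addn_eq0.
rewrite (gtn_eqF p_gt0) /= mul0r add0r mulr_sumr; apply: eq_bigr => k _.
rewrite /term /bump /= add1n mulnS risingD factS !natrM invfM !exprMn.
rewrite [RHS](_ : _ = (k.+1%:R ^+ q * k.+1%:R^-1 ^+ q) *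
  (p%:R ^+ q * rising z p * (k`!%:R^-1 ^+ q * rising (z + p%:R) (p * k)))).
  by rewrite -exprMn mulfV ?pnatr_eq0 // expr1n mul1r.
by rewrite -mulnS natrM exprMn; ring.
Qed.

(** From c r^lam <= ln [growth r] <= K r^lam, the iterated logarithm differs from lam ln r by at
    most the constant [A]. *)
Lemma growth_order_sum : growth_order f = (p%:R / q%:R)%:E.
Proof.
apply: limf_esup_fin.
have ln2 : 0 < ln 2 :> R by rewrite ln_gt0 // ltr1n.
pose c : R := ln 2 / 4; pose K : R := 1 + d%:R * growth_base p.
have c0 : 0 < c by rewrite divr_gt0 // ltr0n.
have B1 : 1 <= growth_base p :> R := growth_base_ge1 p.
have K0 : 0 < K by rewrite ltr_pwDl // mulr_ge0 // (le_trans _ B1).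
have q0 : 0 < q%:R :> R by rewrite ltr0n addn_gt0 p_gt0.
set lam : R := p%:R / q%:R.
have lam0 : 0 < lam by rewrite divr_gt0 // ltr0n.
pose A := `|ln c| + `|ln K|.
apply/cvgrPdist_lt => e e0; near=> r.
(* In the exponent, 3/lam yields s^p >= 1 + 3, A/e makes A / ln r at most e, and the 1 gives ln r >
   0 and strictness. *)
have r_large : expR (1 + 3 / lam + A / e) <= r.
  by near: r; apply: nbhs_pinfty_ge; exact: num_real.
have A0 : 0 <= A by rewrite addr_ge0.
have r0 : 0 < r by apply: lt_le_trans r_large; exact: expR_gt0.
have lnr : 1 + 3 / lam + A / e <= ln r by rewrite -ler_expR lnK.
have lamV : 0 < lam^-1 by rewrite invr_gt0.
have Ae : 0 <= A / e by rewrite divr_ge0 // ltW.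
have lnr0 : 0 < ln r by lra.
have lam_ln : 3 <= lam * ln r.
  by rewrite mulrC -ler_pdivrMr //; lra.
pose s := expR (ln r / q%:R).
have sq : s ^+ q = r by rewrite -expRM_natl mulrC divfK ?gt_eqF // lnK.
have sp : s ^+ p = expR (lam * ln r).
  by rewrite -expRM_natl; congr expR; rewrite /lam; ring.
have s1 : 1 <= s by rewrite -[X in X <= _]expR0 ler_expR divr_ge0 // ltW.
have x4 : 4 <= s ^+ p.
  by rewrite sp; apply: le_trans (expR_ge1Dx _); lra.
have lo := growth_ge s1 x4; have hi := growth_le s1.
rewrite max_modulus_sum ?ltW //; rewrite sq sp -/c -/K in lo hi.
have g0 : 0 < growth r by apply: lt_le_trans lo; exact: expR_gt0.
have lo1 : c * expR (lam * ln r) <= ln (growth r) by rewrite -ler_expR lnK.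
have hi1 : ln (growth r) <= K * expR (lam * ln r) by rewrite -ler_expR lnK.
have pos1 : 0 < c * expR (lam * ln r) by rewrite mulr_gt0 ?expR_gt0.
have pos2 : 0 < ln (growth r) := lt_le_trans pos1 lo1.
have lo2 : ln c + lam * ln r <= ln (ln (growth r)).
  by rewrite -[X in _ + X]expRK -lnM ?posrE ?expR_gt0 // ler_ln ?posrE.
have hi2 : ln (ln (growth r)) <= ln K + lam * ln r.
  rewrite -[X in _ + X]expRK -lnM ?posrE ?expR_gt0 // ler_ln ?posrE //.
  by rewrite mulr_gt0 ?expR_gt0.
have -> : lam - ln (ln (growth r)) / ln r
    = (lam * ln r - ln (ln (growth r))) / ln r by field; rewrite gt_eqF.
rewrite normrM normfV (gtr0_norm lnr0) ltr_pdivrMr //.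
apply: (@le_lt_trans _ _ A).
  have := ler_norm (ln K); have := ler_norm (- ln c); rewrite normrN /A ler_norml.
  by have := normr_ge0 (ln K); have := normr_ge0 (ln c); lra.
by rewrite mulrC -ltr_pdivrMr //; lra.
Unshelve. all: by end_near.
Qed.

End Sum.
End Solution.

Theorem theorem6p1 (R : realType) (lam : rat) (lam_gt0 : 0 < lam)
    (lam_lt1 : lam < 1) :
  exists (m : nat) (P : 'I_m.+1 -> {poly R[i]}) (f : R[i] -> R[i]),
    [/\ (1 <= m)%N,
        P ord_max != 0,
        entire f,
        growth_order f = (ratr lam)%:E &
        forall z : R[i],
          \sum_(k < m.+1) (P k).[z] * iter k (@fdiff R) f z = 0].
Proof.
(* The hypothesis lam < 1 becomes d = q - p > 0 for the reduced fraction p/q. *)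
have [p [d [p0 d0 lamE]]] : exists p d : nat,
    [/\ (0 < p)%N, (0 < d)%N & lam = p%:R / (p + d)%:R].
  have := divq_num_den lam; have := denq_gt0 lam.
  have : 0 < numq lam by rewrite numq_gt0.
  case: (numq lam) => // p; case: (denq lam) => // q p0 q0 lamE.
  rewrite -lamE ltr_pdivrMr ?ltr0z // mul1r ltr_int in lam_lt1.
  by exists p, (q - p)%N; rewrite subnKC ?subn_gt0 // ltnW.
have /choice[f fP] : forall z : R[i], exists l,
    ccvg (fun n => \sum_(k < n) term p d z k) l.
  by move=> z; exact: ccvg_dominated (normc_term_le p d z)
    (is_cvg_series_term p0 d0 (normc_ge0 z)).
have [A [Aq0 _ AE]] := theta_repr (R := R) (p + d).
(* Coefficients of theta^q f(z) - p^q z^(p) f(z+p), with z^(p) a rising factorial and the shift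
   expanded by [shift_repr]. *)
exists (p + d)%N,
  (fun k => A k - (p%:R ^+ (p + d) * 'C(p, k)%:R)%:P * rising 'X p), f.
split.
- by rewrite addn_gt0 p0.
(* At k = p + d > p the binomial vanishes, leaving the nonzero leading coefficient of theta^q. *)
- by rewrite /= bin_small ?mulr0 ?mul0r ?subr0 // -{1}[p]addn0 ltn_add2l.
- exact: entire_sum fP.
- rewrite (growth_order_sum p0 d0 fP) lamE.
  by rewrite fmorph_div !rmorph_nat.
- move=> z; have := iter_theta_sum p0 fP z.
  rewrite AE (@shift_repr _ (p + d).+1) ?ltnS ?leq_addr // mulr_sumr => eqz.
  under eq_bigr do rewrite hornerD hornerN hornerM hornerC horner_risingX mulrBl.
  rewrite sumrB eqz; apply/eqP; rewrite subr_eq0; apply/eqP.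
  by apply: eq_bigr => k _; ring.
Qed.
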